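(* Let $G\dashv R$ be a monoidal adjunction with $G\colon\mathcal{C}\to\mathcal{D}$ and $R\colon\mathcal{D}\to\mathcal{C}$ such that the projection formula holds for $R$ and $G$ is essentially surjective. Then $G\dashv R$ is equivalent as a monoidal adjunction to the Kleisli adjunction $\mathrm{Free}\dashv\mathrm{Forg}$, $\mathrm{Free}\colon\mathcal{C}\to\mathbf{Klei}(T)$, for the monoidal monad $T=RG$.
   Context: Conventions: monoidal categories are written as if strict. $\mathbf{Cat}^{\otimes}_{\mathrm{lax}}$ is the strict bicategory of monoidal categories, lax monoidal functors (structure maps $\mathrm{lax}^F_{X,Y}\colon FX\otimes FY\to F(X\otimes Y)$, $\mathrm{lax}^F_0\colon\mathbb{1}\to F\mathbb{1}$) and monoidal transformations. A monoidal adjunction is an adjunction internal to $\mathbf{Cat}^{\otimes}_{\mathrm{lax}}$, i.e. $G,R$ are lax monoidal and unit, counit are monoidal transformations (then $G$ is strong monoidal). A monoidal monad is a monad internal to $\mathbf{Cat}^{\otimes}_{\mathrm{lax}}$; $T=RG$ is one. Projection formula: $\mathrm{lproj}_{A,X}=\mathrm{lax}^R_{GA,X}\circ(\mathrm{unit}_A\otimes RX)\colon A\otimes RX\to R(GA\otimes X)$ and $\mathrm{rproj}_{X,A}=\mathrm{lax}^R_{X,GA}\circ(RX\otimes\mathrm{unit}_A)\colon RX\otimes A\to R(X\otimes GA)$ are isomorphisms for all $A\in\mathcal{C}$, $X\in\mathcal{D}$. Kleisli category $\mathbf{Klei}(T)$: same objects as $\mathcal{C}$; a morphism $[\alpha]\colon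 A\to B$ is a morphism $\alpha\colon A\to TB$ of $\mathcal{C}$; identities $[\mathrm{unit}^T_A]$; $[\beta]\circ[\alpha]=[\mathrm{mul}^T_C\circ T\beta\circ\alpha]$; monoidal via $\otimes$ of $\mathcal{C}$ on objects and $[\alpha]\otimes[\gamma]=[\mathrm{lax}^T\circ(\alpha\otimes\gamma)]$. $\mathrm{Free}(A)=A$, $\mathrm{Free}(\alpha)=[\mathrm{unit}^T_B\circ\alpha]$ (strict monoidal); $\mathrm{Forg}(A)=TA$, $\mathrm{Forg}([\alpha])=\mathrm{mul}^T_B\circ T\alpha$, with lax structure $\mathrm{lax}^T$. Equivalence of monoidal adjunctions: consider the strict bicategory $\mathbf{Adj}$ whose objects are the monoidal adjunctions; whose 1-morphisms from $(G\dashv R\colon C\rightleftarrows D)$ to $(G'\dashv R'\colon C'\rightleftarrows D')$ are quadruples $(U,V,\alpha,\beta)$ with lax monoidal functors $U\colon C\to C'$, $V\colon D\to D'$ and monoidal transformations $\alpha\colon G'U\to VG$, $\beta\colon UR\to R'V$ that are mates, i.e. $\beta=(R'V\,\mathrm{counit})\circ(R'\alpha R)\circ(\mathrm{unit}'\,UR)$; and whose 2-morphisms $(U_1,V_1,\alpha_1,\beta_1)\to(U_2,V_2,\alpha_2,\beta_2)$ are pairs of monoidal transformations $\tau\colon U_1\to U_2$, $\sigma\colon V_1\to V_2$ with $\alpha_2\circ(G'\tau)=(\sigma G)\circ\alpha_1$ and $\beta_2\circ(\tau R)=(R'\sigma)\circ\beta_1$. Composition is by pasting. Two monoidal adjunctions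 are equivalent as monoidal adjunctions if they are equivalent objects of $\mathbf{Adj}$ (there are 1-morphisms in both directions whose composites are isomorphic to identities). *)

(* Defs.v *)
From Corelib Require Import ssreflect ssrfun.

Set Implicit Arguments.
Unset Strict Implicit.
Unset Printing Implicit Defensive.

#[local] Obligation Tactic := idtac.

Declare Scope cat_scope.
Delimit Scope cat_scope with cat.
Local Open Scope cat_scope.

Record category := Category {
  obj :> Type;
  hom : obj -> obj -> Type;
  idm : forall a, hom a a;
  comp : forall a b c, hom b c -> hom a b -> hom a c;
  comp1m : forall a b (f : hom a b), comp (idm b) f = f;
  compm1 : forall a b (f : hom a b), comp f (idm a) = f;
  compA : forall a b c d (h : hom c d) (g : hom b c) (f : hom a b),
    comp h (comp g f) = comp (comp h g) f
}.
Arguments hom {c} a b : rename.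
Arguments idm {c} a : rename.
Arguments comp {c a b c0} g f : rename.

Notation "a ~> b" := (hom a b)
  (at level 99, b at level 200, no associativity) : cat_scope.
Notation "g ∘ f" := (comp g f) (at level 40, left associativity) : cat_scope.

Definition is_iso (C : category) (a b : C) (f : a ~> b) : Prop :=
  exists g : b ~> a, g ∘ f = idm a /\ f ∘ g = idm b.

Record functor (C D : category) := Functor {
  fobj :> C -> D;
  fmap : forall a b, (a ~> b) -> (fobj a ~> fobj b);
  fmap1 : forall a, fmap (idm a) = idm (fobj a);
  fmapM : forall a b c (g : b ~> c) (f : a ~> b),
    fmap (g ∘ f) = fmap g ∘ fmap f
}.
Arguments fmap {C D} F {a b} f : rename.

Definition essentially_surjective (C D : category) (F : functor C D) : Prop :=
  forall x : D, exists (a : C) (f : F a ~> x), is_iso f.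

(* Associators and unitors are explicit: strictness is not assumed. *)
Record monoidal_category := MonoidalCategory {
  mcat :> category;
  munit : mcat;
  tens : mcat -> mcat -> mcat;
  tensm : forall a b c d : mcat,
    (a ~> b) -> (c ~> d) -> (tens a c ~> tens b d);
  tensm1 : forall a b : mcat, tensm (idm a) (idm b) = idm (tens a b);
  tensmM : forall (a b c a' b' c' : mcat)
      (g : b ~> c) (f : a ~> b) (g' : b' ~> c') (f' : a' ~> b'),
    tensm (g ∘ f) (g' ∘ f') = tensm g g' ∘ tensm f f';
  assoc : forall a b c : mcat, tens (tens a b) c ~> tens a (tens b c);
  lunit : forall a : mcat, tens munit a ~> a;
  runit : forall a : mcat, tens a munit ~> a;
  assoc_iso : forall a b c : mcat, is_iso (assoc a b c);
  lunit_iso : forall a : mcat, is_iso (lunit a);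
  runit_iso : forall a : mcat, is_iso (runit a);
  assoc_nat : forall (a b c a' b' c' : mcat)
      (f : a ~> a') (g : b ~> b') (h : c ~> c'),
    assoc a' b' c' ∘ tensm (tensm f g) h
    = tensm f (tensm g h) ∘ assoc a b c;
  lunit_nat : forall (a b : mcat) (f : a ~> b),
    lunit b ∘ tensm (idm munit) f = f ∘ lunit a;
  runit_nat : forall (a b : mcat) (f : a ~> b),
    runit b ∘ tensm f (idm munit) = f ∘ runit a;
  pentagon : forall a b c d : mcat,
    assoc a b (tens c d) ∘ assoc (tens a b) c d
    = tensm (idm a) (assoc b c d) ∘ assoc a (tens b c) d
        ∘ tensm (assoc a b c) (idm d);
  triangle : forall a b : mcat,
    tensm (idm a) (lunit b) ∘ assoc a munit b = tensm (runit a) (idm b)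
}.
Arguments munit {m}.
Arguments tens {m} a b.
Arguments tensm {m a b c d} f g.
Arguments assoc {m} a b c.
Arguments lunit {m} a.
Arguments runit {m} a.

Notation "a ⊗ b" := (tens a b) (at level 34, left associativity) : cat_scope.
Notation "f ⊗ₘ g" := (tensm f g) (at level 34, left associativity) : cat_scope.

Record lax_functor (C D : monoidal_category) := LaxFunctor {
  lfun :> functor C D;
  lax2 : forall a b : C, lfun a ⊗ lfun b ~> lfun (a ⊗ b);
  lax0 : munit ~> lfun munit;
  lax2_nat : forall (a b a' b' : C) (f : a ~> a') (g : b ~> b'),
    lax2 a' b' ∘ (fmap lfun f ⊗ₘ fmap lfun g)
    = fmap lfun (f ⊗ₘ g) ∘ lax2 a b;
  lax2_assoc : forall a b c : C,
    fmap lfun (assoc a b c) ∘ lax2 (a ⊗ b) c ∘ (lax2 a b ⊗ₘ idm (lfun c))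
    = lax2 a (b ⊗ c) ∘ (idm (lfun a) ⊗ₘ lax2 b c)
        ∘ assoc (lfun a) (lfun b) (lfun c);
  lax_lunit : forall a : C,
    fmap lfun (lunit a) ∘ lax2 munit a ∘ (lax0 ⊗ₘ idm (lfun a))
    = lunit (lfun a);
  lax_runit : forall a : C,
    fmap lfun (runit a) ∘ lax2 a munit ∘ (idm (lfun a) ⊗ₘ lax0)
    = runit (lfun a)
}.
Arguments lax2 {C D} F a b : rename.
Arguments lax0 {C D} F : rename.

Record mon_trans (C D : monoidal_category) (F G : lax_functor C D) := MonTrans {
  mtr :> forall a : C, F a ~> G a;
  mtr_nat : forall (a b : C) (f : a ~> b),
    mtr b ∘ fmap F f = fmap G f ∘ mtr a;
  mtr_lax2 : forall a b : C,
    mtr (a ⊗ b) ∘ lax2 F a b = lax2 G a b ∘ (mtr a ⊗ₘ mtr b);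
  mtr_lax0 : mtr munit ∘ lax0 F = lax0 G
}.

Program Definition functor_id (C : category) : functor C C :=
  {| fobj := fun a => a; fmap := fun a b f => f |}.
Next Obligation. by []. Qed.
Next Obligation. by []. Qed.

Program Definition functor_comp (C D E : category)
    (G : functor D E) (F : functor C D) : functor C E :=
  {| fobj := fun a => G (F a); fmap := fun a b f => fmap G (fmap F f) |}.
Next Obligation. by move=> C D E G F a /=; rewrite !fmap1. Qed.
Next Obligation. by move=> C D E G F a b c g f /=; rewrite !fmapM. Qed.

Program Definition lax_id (C : monoidal_category) : lax_functor C C :=
  {| lfun := functor_id C;
     lax2 := fun a b => idm (a ⊗ b);
     lax0 := idm munit |}.
Next Obligation. by move=> C * /=; rewrite comp1m compm1. Qed.
Next Obligation. by move=> C * /=; rewrite !tensm1 !compm1 !comp1m. Qed.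
Next Obligation. by move=> C * /=; rewrite tensm1 !compm1. Qed.
Next Obligation. by move=> C * /=; rewrite tensm1 !compm1. Qed.

Program Definition lax_comp (C D E : monoidal_category)
    (G : lax_functor D E) (F : lax_functor C D) : lax_functor C E :=
  {| lfun := functor_comp G F;
     lax2 := fun a b => fmap G (lax2 F a b) ∘ lax2 G (F a) (F b);
     lax0 := fmap G (lax0 F) ∘ lax0 G |}.
Next Obligation.
move=> C D E G F a b a' b' f g /=.
by rewrite -compA lax2_nat !compA -!fmapM lax2_nat.
Qed.
Next Obligation.
move=> C D E G F a b c /=.
have -> : idm (G (F c)) = fmap G (idm (F c)) ∘ idm (G (F c))
  by rewrite fmap1 comp1m.
have -> : idm (G (F a)) = fmap G (idm (F a)) ∘ idm (G (F a))
  by rewrite fmap1 comp1m.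
rewrite !tensmM !compA -(compA _ (lax2 G (F (a ⊗ b)) (F c))) lax2_nat.
rewrite -(compA _ (lax2 G (F a) (F (b ⊗ c)))) lax2_nat.
rewrite !compA -!fmapM lax2_assoc.
have := lax2_assoc G (F a) (F b) (F c); rewrite !fmapM -!compA => ->.
by rewrite !compA.
Qed.
Next Obligation.
move=> C D E G F a /=.
have -> : idm (G (F a)) = fmap G (idm (F a)) ∘ idm (G (F a))
  by rewrite fmap1 comp1m.
rewrite tensmM !compA -(compA _ (lax2 G (F munit) (F a))) lax2_nat.
by rewrite !compA -!fmapM lax_lunit lax_lunit.
Qed.
Next Obligation.
move=> C D E G F a /=.
have -> : idm (G (F a)) = fmap G (idm (F a)) ∘ idm (G (F a))
  by rewrite fmap1 comp1m.
rewrite tensmM !compA -(compA _ (lax2 G (F a) (F munit))) lax2_nat.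
by rewrite !compA -!fmapM lax_runit lax_runit.
Qed.

Program Definition mtr_id (C D : monoidal_category) (F : lax_functor C D) :
    mon_trans F F :=
  {| mtr := fun a => idm (F a) |}.
Next Obligation. by move=> C D F *; rewrite comp1m compm1. Qed.
Next Obligation. by move=> C D F *; rewrite tensm1 comp1m compm1. Qed.
Next Obligation. by move=> C D F; rewrite comp1m. Qed.

Program Definition mtr_comp (C D : monoidal_category) (F G H : lax_functor C D)
    (t : mon_trans G H) (s : mon_trans F G) : mon_trans F H :=
  {| mtr := fun a => t a ∘ s a |}.
Next Obligation.
by move=> C D F G H t s a b f; rewrite -compA mtr_nat compA mtr_nat compA.
Qed.
Next Obligation.
by move=> C D F G H t s a b; rewrite -compA mtr_lax2 compA mtr_lax2 tensmM compA.
Qed.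
Next Obligation. by move=> C D F G H t s; rewrite -compA !mtr_lax0. Qed.

Record mon_adjunction (C D : monoidal_category) := MonAdjunction {
  ladj : lax_functor C D;
  radj : lax_functor D C;
  adj_unit : mon_trans (lax_id C) (lax_comp radj ladj);
  adj_counit : mon_trans (lax_comp ladj radj) (lax_id D);
  adj_triangle_l : forall a : C,
    adj_counit (ladj a) ∘ fmap ladj (adj_unit a) = idm (ladj a);
  adj_triangle_r : forall x : D,
    fmap radj (adj_counit x) ∘ adj_unit (radj x) = idm (radj x)
}.

Definition lproj (C D : monoidal_category) (A : mon_adjunction C D)
    (a : C) (x : D) : a ⊗ radj A x ~> radj A (ladj A a ⊗ x) :=
  lax2 (radj A) (ladj A a) x ∘ (adj_unit A a ⊗ₘ idm (radj A x)).

Definition rproj (C D : monoidal_category) (A : mon_adjunction C D)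
    (x : D) (a : C) : radj A x ⊗ a ~> radj A (x ⊗ ladj A a) :=
  lax2 (radj A) x (ladj A a) ∘ (idm (radj A x) ⊗ₘ adj_unit A a).

Definition projection_formula (C D : monoidal_category)
    (A : mon_adjunction C D) : Prop :=
  forall (a : C) (x : D), is_iso (lproj A a x) /\ is_iso (rproj A x a).

Record mon_monad (C : monoidal_category) := MonMonad {
  mnd :> lax_functor C C;
  mnd_unit : mon_trans (lax_id C) mnd;
  mnd_mul : mon_trans (lax_comp mnd mnd) mnd;
  mnd_mul1l : forall a : C, mnd_mul a ∘ mnd_unit (mnd a) = idm (mnd a);
  mnd_mul1r : forall a : C, mnd_mul a ∘ fmap mnd (mnd_unit a) = idm (mnd a);
  mnd_mulA : forall a : C,
    mnd_mul a ∘ mnd_mul (mnd a) = mnd_mul a ∘ fmap mnd (mnd_mul a)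
}.

Program Definition adj_mul (C D : monoidal_category) (A : mon_adjunction C D) :
    mon_trans (lax_comp (lax_comp (radj A) (ladj A)) (lax_comp (radj A) (ladj A)))
              (lax_comp (radj A) (ladj A)) :=
  {| mtr := fun a => fmap (radj A) (adj_counit A (ladj A a)) |}.
Next Obligation.
move=> C D A a b f /=; rewrite -!fmapM; congr (fmap _ _).
exact: (mtr_nat (adj_counit A)).
Qed.
Next Obligation.
move=> C D A a b /=; rewrite !compA -!fmapM.
have /= E := mtr_nat (adj_counit A) (lax2 (ladj A) a b).
have /= F := mtr_lax2 (adj_counit A) (ladj A a) (ladj A b).
rewrite comp1m in F.
rewrite -(compA _ (lax2 _ _ _) (tensm _ _)) lax2_nat !compA -!fmapM.
by rewrite (fmapM (ladj A)) compA E -!compA F.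
Qed.
Next Obligation.
move=> C D A /=; rewrite !compA -!fmapM.
have /= E := mtr_nat (adj_counit A) (lax0 (ladj A)).
have /= F := mtr_lax0 (adj_counit A).
by rewrite (fmapM (ladj A)) compA E -!compA F compm1.
Qed.

Program Definition adj_monad (C D : monoidal_category) (A : mon_adjunction C D) :
    mon_monad C :=
  {| mnd := lax_comp (radj A) (ladj A);
     mnd_unit := adj_unit A;
     mnd_mul := adj_mul A |}.
Next Obligation. by move=> C D A a /=; rewrite adj_triangle_r. Qed.
Next Obligation.
by move=> C D A a /=; rewrite -fmapM adj_triangle_l fmap1.
Qed.
Next Obligation.
move=> C D A a /=; rewrite -!fmapM; congr (fmap _ _).
by have /= -> := mtr_nat (adj_counit A) (adj_counit A (ladj A a)).
Qed.

Definition kl_comp (C : monoidal_category) (T : mon_monad C) (a b c : C)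
    (g : b ~> T c) (f : a ~> T b) : a ~> T c :=
  mnd_mul T c ∘ fmap T g ∘ f.

Definition kl_tens (C : monoidal_category) (T : mon_monad C) (a b c d : C)
    (f : a ~> T b) (g : c ~> T d) : a ⊗ c ~> T (b ⊗ d) :=
  lax2 T b d ∘ (f ⊗ₘ g).

Definition kl_free (C : monoidal_category) (T : mon_monad C) (a b : C)
    (f : a ~> b) : a ~> T b :=
  mnd_unit T b ∘ f.

Lemma mnd_mul_unit (C : monoidal_category) (T : mon_monad C) (a b : C)
    (f : a ~> T b) : mnd_mul T b ∘ fmap T f ∘ mnd_unit T a = f.
Proof.
have /= E := mtr_nat (mnd_unit T) f.
by rewrite -compA -E compA mnd_mul1l comp1m.
Qed.

Program Definition kleisli (C : monoidal_category) (T : mon_monad C) : category :=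
  {| obj := obj C;
     hom := fun a b => hom a (T b);
     idm := fun a => mnd_unit T a;
     comp := fun a b c g f => kl_comp g f |}.
Next Obligation.
by move=> C T a b f; rewrite /kl_comp mnd_mul1r comp1m.
Qed.
Next Obligation. by move=> C T a b f; exact: mnd_mul_unit. Qed.
Next Obligation.
move=> C T a b c d h g f; rewrite /kl_comp !fmapM !compA -mnd_mulA.
have /= E := mtr_nat (mnd_mul T) h.
by rewrite -(compA _ (mnd_mul T (T d))) E !compA.
Qed.

Lemma kl_freeM (C : monoidal_category) (T : mon_monad C) (a b c : C)
    (g : b ~> c) (f : a ~> b) :
  kl_free T (g ∘ f) = kl_comp (kl_free T g) (kl_free T f).
Proof. by rewrite /kl_comp /kl_free compA mnd_mul_unit compA. Qed.

Lemma kl_comp_freer (C : monoidal_category) (T : mon_monad C) (a b c : C)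
    (g : b ~> T c) (f : a ~> b) : kl_comp g (kl_free T f) = g ∘ f.
Proof. by rewrite /kl_comp /kl_free compA mnd_mul_unit. Qed.

Lemma kl_comp_freel (C : monoidal_category) (T : mon_monad C) (a b c : C)
    (g : b ~> c) (f : a ~> T b) : kl_comp (kl_free T g) f = fmap T g ∘ f.
Proof. by rewrite /kl_comp /kl_free fmapM compA mnd_mul1r comp1m. Qed.

Lemma kl_tens_free (C : monoidal_category) (T : mon_monad C) (a b c d : C)
    (f : a ~> b) (g : c ~> d) :
  kl_tens (kl_free T f) (kl_free T g) = kl_free T (f ⊗ₘ g).
Proof.
have /= E := mtr_lax2 (mnd_unit T) b d.
by rewrite /kl_tens /kl_free tensmM compA -E compm1.
Qed.

Lemma kl_free1 (C : monoidal_category) (T : mon_monad C) (a : C) :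
  kl_free T (idm a) = mnd_unit T a.
Proof. exact: compm1. Qed.

Lemma kl_tensM (C : monoidal_category) (T : mon_monad C) (a b c a' b' c' : C)
    (g : b ~> T c) (f : a ~> T b) (g' : b' ~> T c') (f' : a' ~> T b') :
  kl_tens (kl_comp g f) (kl_comp g' f')
  = kl_comp (kl_tens g g') (kl_tens f f').
Proof.
have /= E := mtr_lax2 (mnd_mul T) c c'.
rewrite /kl_tens /kl_comp !tensmM !compA -E fmapM -!compA.
by rewrite (compA (lax2 T (T c) (T c'))) lax2_nat !compA.
Qed.

Lemma kl_free_iso (C : monoidal_category) (T : mon_monad C) (a b : C)
    (f : a ~> b) : is_iso f -> @is_iso (kleisli T) a b (kl_free T f).
Proof.
move=> [g [gf fg]]; exists (kl_free T g).
by rewrite /= -!kl_freeM gf fg !kl_free1.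
Qed.

Program Definition kleisli_mon (C : monoidal_category) (T : mon_monad C) :
    monoidal_category :=
  {| mcat := kleisli T;
     munit := @munit C;
     tens := @tens C;
     tensm := fun a b c d f g => kl_tens f g;
     assoc := fun a b c => kl_free T (assoc a b c);
     lunit := fun a => kl_free T (lunit a);
     runit := fun a => kl_free T (runit a) |}.
Next Obligation.
by move=> C T a b /=; rewrite -!kl_free1 kl_tens_free tensm1.
Qed.
Next Obligation. by move=> C T *; exact: kl_tensM. Qed.
Next Obligation. by move=> C T a b c; apply/kl_free_iso/assoc_iso. Qed.
Next Obligation. by move=> C T a; apply/kl_free_iso/lunit_iso. Qed.
Next Obligation. by move=> C T a; apply/kl_free_iso/runit_iso. Qed.
Next Obligation.
move=> C T a b c a' b' c' f g h /=.
rewrite kl_comp_freel kl_comp_freer /kl_tens -!compA.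
have -> : (lax2 T a' b' ∘ (f ⊗ₘ g)) ⊗ₘ h
  = (lax2 T a' b' ⊗ₘ idm (T c')) ∘ ((f ⊗ₘ g) ⊗ₘ h) by rewrite -tensmM comp1m.
have -> : f ⊗ₘ (lax2 T b' c' ∘ (g ⊗ₘ h))
  = (idm (T a') ⊗ₘ lax2 T b' c') ∘ (f ⊗ₘ (g ⊗ₘ h)) by rewrite -tensmM comp1m.
by rewrite !compA lax2_assoc -!compA assoc_nat !compA.
Qed.
Next Obligation.
move=> C T a b f /=; rewrite kl_comp_freel kl_comp_freer /kl_tens.
have /= E := mtr_lax0 (mnd_unit T); rewrite compm1 in E.
have -> : mnd_unit T munit ⊗ₘ f = (lax0 T ⊗ₘ idm (T b)) ∘ (idm munit ⊗ₘ f)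
  by rewrite -tensmM comp1m compm1 E.
by rewrite !compA lax_lunit lunit_nat.
Qed.
Next Obligation.
move=> C T a b f /=; rewrite kl_comp_freel kl_comp_freer /kl_tens.
have /= E := mtr_lax0 (mnd_unit T); rewrite compm1 in E.
have -> : f ⊗ₘ mnd_unit T munit = (idm (T b) ⊗ₘ lax0 T) ∘ (f ⊗ₘ idm munit)
  by rewrite -tensmM comp1m compm1 E.
by rewrite !compA lax_runit runit_nat.
Qed.
Next Obligation.
by move=> C T a b c d /=; rewrite -!kl_free1 !kl_tens_free -!kl_freeM pentagon.
Qed.
Next Obligation.
by move=> C T a b /=; rewrite -!kl_free1 !kl_tens_free -!kl_freeM triangle.
Qed.

Program Definition free_functor (C : monoidal_category) (T : mon_monad C) :
    functor C (kleisli T) :=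
  {| fobj := fun a => a; fmap := fun a b f => kl_free T f |}.
Next Obligation. by move=> C T a; exact: kl_free1. Qed.
Next Obligation. by move=> C T *; exact: kl_freeM. Qed.

Program Definition free (C : monoidal_category) (T : mon_monad C) :
    lax_functor C (kleisli_mon T) :=
  {| lfun := free_functor T;
     lax2 := fun a b => @idm (kleisli T) (a ⊗ b);
     lax0 := @idm (kleisli T) munit |}.
Next Obligation.
move=> C T a b a' b' f g; rewrite comp1m compm1; exact: kl_tens_free.
Qed.
Next Obligation.
move=> C T a b c.
by rewrite !(tensm1 (m := kleisli_mon T)) !compm1 comp1m.
Qed.
Next Obligation.
by move=> C T a; rewrite (tensm1 (m := kleisli_mon T)) !compm1.
Qed.
Next Obligation.
by move=> C T a; rewrite (tensm1 (m := kleisli_mon T)) !compm1.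
Qed.

Program Definition forg_functor (C : monoidal_category) (T : mon_monad C) :
    functor (kleisli T) C :=
  {| fobj := fun a => T a; fmap := fun a b f => mnd_mul T b ∘ fmap T f |}.
Next Obligation. by move=> C T a; exact: mnd_mul1r. Qed.
Next Obligation.
move=> C T a b c g f /=.
have /= E := mtr_nat (mnd_mul T) g.
rewrite /kl_comp !fmapM !compA -mnd_mulA.
by rewrite -(compA _ (mnd_mul T (T c))) E !compA.
Qed.

Program Definition forg (C : monoidal_category) (T : mon_monad C) :
    lax_functor (kleisli_mon T) C :=
  {| lfun := forg_functor T;
     lax2 := fun a b => lax2 T a b;
     lax0 := lax0 T |}.
Next Obligation.
move=> C T a b a' b' f g /=.
have /= E := mtr_lax2 (mnd_mul T) a' b'.
by rewrite tensmM compA -E /kl_tens fmapM -!compA lax2_nat.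
Qed.
Next Obligation.
by move=> C T a b c /=; rewrite /kl_free fmapM compA mnd_mul1r comp1m lax2_assoc.
Qed.
Next Obligation.
by move=> C T a /=; rewrite /kl_free fmapM compA mnd_mul1r comp1m lax_lunit.
Qed.
Next Obligation.
by move=> C T a /=; rewrite /kl_free fmapM compA mnd_mul1r comp1m lax_runit.
Qed.

Program Definition kleisli_unit (C : monoidal_category) (T : mon_monad C) :
    mon_trans (lax_id C) (lax_comp (forg T) (free T)) :=
  {| mtr := fun a => mnd_unit T a |}.
Next Obligation.
move=> C T a b f /=; rewrite /kl_free fmapM compA mnd_mul1r comp1m.
exact: (mtr_nat (mnd_unit T)).
Qed.
Next Obligation.
move=> C T a b /=; rewrite mnd_mul1r comp1m; exact: (mtr_lax2 (mnd_unit T)).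
Qed.
Next Obligation.
move=> C T /=; rewrite mnd_mul1r comp1m; exact: (mtr_lax0 (mnd_unit T)).
Qed.

(* The component at [a] is the Kleisli morphism [T a -> a] given by [idm (T a)]. *)
Program Definition kleisli_counit (C : monoidal_category) (T : mon_monad C) :
    mon_trans (lax_comp (free T) (forg T)) (lax_id (kleisli_mon T)) :=
  {| mtr := fun a => @idm C (T a) |}.
Next Obligation.
move=> C T a b f /=; rewrite kl_comp_freer.
by rewrite /kl_comp comp1m compm1.
Qed.
Next Obligation.
move=> C T a b /=; rewrite -(kl_free1 T (T a ⊗ T b)).
rewrite /kl_tens tensm1 -(kl_freeM T) kl_comp_freer /kl_comp.
by rewrite mnd_mul1r !comp1m !compm1.
Qed.
Next Obligation.
move=> C T /=; rewrite -(kl_free1 T (@munit C)) -(kl_freeM T) kl_comp_freer.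
have /= E := mtr_lax0 (mnd_unit T); rewrite compm1 in E.
by rewrite comp1m compm1 kl_free1 E.
Qed.

Program Definition kleisli_adj (C : monoidal_category) (T : mon_monad C) :
    mon_adjunction C (kleisli_mon T) :=
  {| ladj := free T;
     radj := forg T;
     adj_unit := kleisli_unit T;
     adj_counit := kleisli_counit T |}.
Next Obligation. by move=> C T a /=; rewrite kl_comp_freer comp1m. Qed.
Next Obligation.
by move=> C T a /=; rewrite fmap1 compm1 mnd_mul1l.
Qed.

Record adj_mor (C D C' D' : monoidal_category)
    (A : mon_adjunction C D) (A' : mon_adjunction C' D') := AdjMor {
  am_l : lax_functor C C';
  am_r : lax_functor D D';
  am_alpha : mon_trans (lax_comp (ladj A') am_l) (lax_comp am_r (ladj A));
  am_beta : mon_trans (lax_comp am_l (radj A)) (lax_comp (radj A') am_r);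
  am_mate : forall x : D,
    am_beta x = fmap (radj A') (fmap am_r (adj_counit A x))
                ∘ fmap (radj A') (am_alpha (radj A x))
                ∘ adj_unit A' (am_l (radj A x))
}.

Program Definition adj_mor_id (C D : monoidal_category) (A : mon_adjunction C D) :
    adj_mor A A :=
  {| am_l := lax_id C;
     am_r := lax_id D;
     am_alpha := {| mtr := fun a : C => idm (ladj A a) |};
     am_beta := {| mtr := fun x : D => idm (radj A x) |} |}.
Next Obligation. by move=> C D A *; rewrite /= comp1m compm1. Qed.
Next Obligation.
by move=> C D A *; rewrite /= tensm1 fmap1 !compm1 !comp1m.
Qed.
Next Obligation. by move=> C D A; rewrite /= fmap1 !comp1m compm1. Qed.
Next Obligation. by move=> C D A *; rewrite /= comp1m compm1. Qed.
Next Obligation.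
by move=> C D A *; rewrite /= tensm1 fmap1 !compm1 !comp1m.
Qed.
Next Obligation. by move=> C D A; rewrite /= fmap1 !comp1m compm1. Qed.
Next Obligation.
by move=> C D A x /=; rewrite fmap1 compm1 adj_triangle_r.
Qed.

(* Pasting: [(V' alpha) o (alpha' U)] and [(beta' V) o (U' beta)]. *)
Program Definition adj_mor_comp (C D C' D' C'' D'' : monoidal_category)
    (A : mon_adjunction C D) (A' : mon_adjunction C' D')
    (A'' : mon_adjunction C'' D'') (g : adj_mor A' A'') (f : adj_mor A A') :
    adj_mor A A'' :=
  {| am_l := lax_comp (am_l g) (am_l f);
     am_r := lax_comp (am_r g) (am_r f);
     am_alpha := {| mtr := fun a : C =>
       fmap (am_r g) (am_alpha f a) ∘ am_alpha g (am_l f a) |};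
     am_beta := {| mtr := fun x : D =>
       am_beta g (am_r f x) ∘ fmap (am_l g) (am_beta f x) |} |}.
Next Obligation.
move=> C D C' D' C2 D2 A A' A2 g f a b h /=.
have /= E := mtr_nat (am_alpha g) (fmap (am_l f) h).
have /= F := mtr_nat (am_alpha f) h.
by rewrite -compA E compA -fmapM F fmapM compA.
Qed.
Next Obligation.
move=> C D C' D' C2 D2 A A' A2 g f a b /=.
have /= E := mtr_lax2 (am_alpha g) (am_l f a) (am_l f b).
have /= N := mtr_nat (am_alpha g) (lax2 (am_l f) a b).
have /= F := mtr_lax2 (am_alpha f) a b.
rewrite (fmapM (ladj A2)) -!compA (compA (am_alpha g _) (fmap (ladj A2) _)) N.
rewrite -!compA E tensmM !compA -!fmapM -!compA.
rewrite (compA (lax2 (am_r g) _ _) (fmap (am_r g) _ ⊗ₘ _)) lax2_nat.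
by rewrite !compA -!fmapM -!compA F -?compA.
Qed.
Next Obligation.
move=> C D C' D' C2 D2 A A' A2 g f /=.
have /= E := mtr_lax0 (am_alpha g).
have /= N := mtr_nat (am_alpha g) (lax0 (am_l f)).
have /= F := mtr_lax0 (am_alpha f).
rewrite (fmapM (ladj A2)) -!compA (compA (am_alpha g _) (fmap (ladj A2) _)) N.
by rewrite -!compA E !compA -!fmapM -!compA F -?compA.
Qed.
Next Obligation.
move=> C D C' D' C2 D2 A A' A2 g f x y h /=.
have /= E := mtr_nat (am_beta g) (fmap (am_r f) h).
have /= F := mtr_nat (am_beta f) h.
by rewrite -compA -fmapM F fmapM compA E compA.
Qed.
Next Obligation.
move=> C D C' D' C2 D2 A A' A2 g f x y /=.
have /= E := mtr_lax2 (am_beta g) (am_r f x) (am_r f y).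
have /= N := mtr_nat (am_beta g) (lax2 (am_r f) x y).
have /= F := mtr_lax2 (am_beta f) x y.
rewrite -!compA (compA (fmap (am_l g) (fmap _ _))) -fmapM.
rewrite (compA (fmap (am_l g) (am_beta f _))) -fmapM F.
rewrite !fmapM tensmM -!compA -lax2_nat.
rewrite (compA (am_beta g _) (fmap (am_l g) (fmap _ _))) N -!compA.
congr (_ ∘ _); rewrite !compA; congr (_ ∘ _).
by rewrite -E compA.
Qed.
Next Obligation.
move=> C D C' D' C2 D2 A A' A2 g f /=.
have /= E := mtr_lax0 (am_beta g).
have /= N := mtr_nat (am_beta g) (lax0 (am_r f)).
have /= F := mtr_lax0 (am_beta f).
rewrite -!compA (compA (fmap (am_l g) (fmap _ _))) -fmapM.
rewrite (compA (fmap (am_l g) (am_beta f _))) -fmapM F.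
rewrite !fmapM -!compA (compA (am_beta g _) (fmap (am_l g) (fmap _ _))) N.
by rewrite -!compA E.
Qed.
Next Obligation.
move=> C D C' D' C2 D2 A A' A2 g f x /=.
have /= N := mtr_nat (adj_unit A2) (fmap (am_l g) (am_beta f x)).
have /= K := mtr_nat (am_alpha g) (am_beta f x).
have E : adj_counit A' (am_r f x) ∘ fmap (ladj A') (am_beta f x)
  = fmap (am_r f) (adj_counit A x) ∘ am_alpha f (radj A x).
  rewrite am_mate !fmapM !compA.
  have /= E1 := mtr_nat (adj_counit A') (fmap (am_r f) (adj_counit A x)).
  have /= E2 := mtr_nat (adj_counit A') (am_alpha f (radj A x)).
  have /= E3 := adj_triangle_l A' (am_l f (radj A x)).
  by rewrite E1 -(compA _ (adj_counit A' _)) E2 -!compA E3 compm1.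
rewrite am_mate -!compA N !compA -!fmapM -!compA K.
by rewrite !compA -!fmapM E.
Qed.

Record adj_cell (C D C' D' : monoidal_category)
    (A : mon_adjunction C D) (A' : mon_adjunction C' D')
    (f1 f2 : adj_mor A A') := AdjCell {
  ac_l : mon_trans (am_l f1) (am_l f2);
  ac_r : mon_trans (am_r f1) (am_r f2);
  ac_alpha : forall a : C,
    am_alpha f2 a ∘ fmap (ladj A') (ac_l a) = ac_r (ladj A a) ∘ am_alpha f1 a;
  ac_beta : forall x : D,
    am_beta f2 x ∘ ac_l (radj A x) = fmap (radj A') (ac_r x) ∘ am_beta f1 x
}.

Program Definition adj_cell_id (C D C' D' : monoidal_category)
    (A : mon_adjunction C D) (A' : mon_adjunction C' D') (f : adj_mor A A') :
    adj_cell f f :=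
  {| ac_l := mtr_id (am_l f); ac_r := mtr_id (am_r f) |}.
Next Obligation. by move=> *; rewrite /= fmap1 compm1 comp1m. Qed.
Next Obligation. by move=> *; rewrite /= fmap1 compm1 comp1m. Qed.

Program Definition adj_cell_comp (C D C' D' : monoidal_category)
    (A : mon_adjunction C D) (A' : mon_adjunction C' D')
    (f1 f2 f3 : adj_mor A A') (t : adj_cell f2 f3) (s : adj_cell f1 f2) :
    adj_cell f1 f3 :=
  {| ac_l := mtr_comp (ac_l t) (ac_l s); ac_r := mtr_comp (ac_r t) (ac_r s) |}.
Next Obligation.
move=> C D C' D' A A' f1 f2 f3 t s a /=.
have /= E := ac_alpha t a; have /= F := ac_alpha s a.
by rewrite fmapM compA E -compA F compA.
Qed.
Next Obligation.
move=> C D C' D' A A' f1 f2 f3 t s x /=.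
have /= E := ac_beta t x; have /= F := ac_beta s x.
by rewrite fmapM compA E -compA F compA.
Qed.

(* Equality of the underlying natural transformations, component by component. *)
Definition adj_cell_eq (C D C' D' : monoidal_category)
    (A : mon_adjunction C D) (A' : mon_adjunction C' D')
    (f1 f2 : adj_mor A A') (s t : adj_cell f1 f2) : Prop :=
  (forall a : C, ac_l s a = ac_l t a) /\ (forall x : D, ac_r s x = ac_r t x).

Definition adj_mor_iso (C D C' D' : monoidal_category)
    (A : mon_adjunction C D) (A' : mon_adjunction C' D')
    (f1 f2 : adj_mor A A') : Prop :=
  exists (s : adj_cell f1 f2) (t : adj_cell f2 f1),
    adj_cell_eq (adj_cell_comp t s) (adj_cell_id f1) /\
    adj_cell_eq (adj_cell_comp s t) (adj_cell_id f2).

Definition adj_equivalent (C D C' D' : monoidal_category)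
    (A : mon_adjunction C D) (A' : mon_adjunction C' D') : Prop :=
  exists (f : adj_mor A A') (g : adj_mor A' A),
    adj_mor_iso (adj_mor_comp g f) (adj_mor_id A) /\
    adj_mor_iso (adj_mor_comp f g) (adj_mor_id A').

(* Main.v *)
(* The comparison functor K from Klei(T) to D, acting as G on objects and by
   transposition along the adjunction on morphisms, is fully faithful. It is strong
   monoidal because the oplax structure on G induced by the lax structure of R inverts
   the lax structure of G, and it is essentially surjective because G is. A
   quasi-inverse L of K carries the unique lax structure making the isomorphism from
   K L to the identity monoidal. Together with the identity of C, K and L are
   1-morphisms of monoidal adjunctions, inverse to each other up to isomorphism. *)

From Corelib Require Import ssreflect ssrfun.
From Stdlib Require Import ClassicalEpsilon.
Require Import Defs.

Set Implicit Arguments.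
Unset Strict Implicit.
Unset Printing Implicit Defensive.

#[local] Obligation Tactic := idtac.
Local Open Scope cat_scope.

(** * Isomorphisms and inverses of monoidal transformations *)

Lemma tensm_iso (C : monoidal_category) (a b c d : C) (f : a ~> b) (g : c ~> d) :
  is_iso f -> is_iso g -> is_iso (f ⊗ₘ g).
Proof.
move=> [f' [f'f ff']] [g' [g'g gg']]; exists (f' ⊗ₘ g').
by rewrite -!tensmM f'f g'g ff' gg' !tensm1.
Qed.

Lemma idm_iso (C : category) (a : C) : is_iso (idm a).
Proof. by exists (idm a); rewrite comp1m. Qed.

Lemma iso_epi (C : category) (a b c : C) (f : a ~> b) (g h : b ~> c) :
  is_iso f -> g ∘ f = h ∘ f -> g = h.
Proof.
by move=> [f' [_ ff']] E; rewrite -(compm1 g) -ff' compA E -compA ff' compm1.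
Qed.

Lemma iso_mono (C : category) (a b c : C) (f : b ~> c) (g h : a ~> b) :
  is_iso f -> f ∘ g = f ∘ h -> g = h.
Proof.
by move=> [f' [f'f _]] E; rewrite -(comp1m g) -f'f -compA E compA f'f comp1m.
Qed.

(** Naturality and monoidality of the inverse are automatic: insert [t] followed by [v], move [t]
    across the square by its own axiom, and cancel. *)
Program Definition mtr_inv (C D : monoidal_category) (F G : lax_functor C D)
    (t : mon_trans F G) (v : forall a : C, G a ~> F a)
    (vt : forall a, v a ∘ t a = idm (F a)) (tv : forall a, t a ∘ v a = idm (G a)) :
    mon_trans G F :=
  {| mtr := v |}.
Next Obligation.
move=> C D F G t v vt tv a b f.
rewrite -[LHS]compm1 -(tv a) compA -(compA (v b)) -mtr_nat.
by rewrite (compA (v b)) vt comp1m.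
Qed.
Next Obligation.
move=> C D F G t v vt tv a b.
rewrite -[LHS]compm1 -(tensm1 (G a) (G b)) -(tv a) -(tv b) tensmM compA.
by rewrite -(compA (v _)) -mtr_lax2 (compA (v _)) vt comp1m.
Qed.
Next Obligation.
by move=> C D F G t v vt tv; rewrite -(mtr_lax0 t) compA vt comp1m.
Qed.

(* A strong monoidal, fully faithful, essentially surjective functor; all inverses
   are data, so that its quasi-inverse can be defined without choice. *)
Record weak_equivalence (C D : monoidal_category) (K : lax_functor C D) :=
  WeakEquivalence {
  we_full : forall a b : C, (K a ~> K b) -> (a ~> b);
  we_fullK : forall (a b : C) (h : K a ~> K b), fmap K (we_full h) = h;
  we_faithful : forall (a b : C) (f g : a ~> b), fmap K f = fmap K g -> f = g;
  we_obj : D -> C;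
  we_iso : forall x : D, K (we_obj x) ~> x;
  we_isoV : forall x : D, x ~> K (we_obj x);
  we_isoVK : forall x : D, we_isoV x ∘ we_iso x = idm (K (we_obj x));
  we_isoKV : forall x : D, we_iso x ∘ we_isoV x = idm x;
  we_lax2V : forall a b : C, K (a ⊗ b) ~> K a ⊗ K b;
  we_lax2VK : forall a b : C, we_lax2V a b ∘ lax2 K a b = idm (K a ⊗ K b);
  we_lax2KV : forall a b : C, lax2 K a b ∘ we_lax2V a b = idm (K (a ⊗ b));
  we_lax0V : K munit ~> munit;
  we_lax0VK : we_lax0V ∘ lax0 K = idm munit;
  we_lax0KV : lax0 K ∘ we_lax0V = idm (K munit)
}.

(** * Lax monoidal quasi-inverse of a weak monoidal equivalence *)

Section QuasiInverse.
Context (C D : monoidal_category) (K : lax_functor C D) (w : weak_equivalence K).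

Lemma we_iso_iso (x : D) : is_iso (we_iso w x).
Proof. by exists (we_isoV w x); rewrite we_isoVK we_isoKV. Qed.

Lemma we_lax2_iso (a b : C) : is_iso (lax2 K a b).
Proof. by exists (we_lax2V w a b); rewrite we_lax2VK we_lax2KV. Qed.

Lemma we_lax0_iso : is_iso (lax0 K).
Proof. by exists (we_lax0V w); rewrite we_lax0VK we_lax0KV. Qed.

(** Turns equations of maps into a chosen preimage into equations in [D]; the coherence laws of the
    quasi-inverse are all tested this way. *)
Lemma we_inj (a : C) (x : D) (f g : a ~> we_obj w x) :
  we_iso w x ∘ fmap K f = we_iso w x ∘ fmap K g -> f = g.
Proof. by move=> E; apply/(we_faithful w)/(iso_mono (we_iso_iso x)). Qed.

Definition qinv_map (x y : D) (f : x ~> y) : we_obj w x ~> we_obj w y :=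
  we_full w (we_isoV w y ∘ f ∘ we_iso w x).

(** The only morphism satisfying [qinv_lax2E], which says that [we_iso] respects tensor products;
    its construction uses that [lax2 K] is invertible. *)
Definition qinv_lax2 (x y : D) : we_obj w x ⊗ we_obj w y ~> we_obj w (x ⊗ y) :=
  we_full w (we_isoV w (x ⊗ y) ∘ (we_iso w x ⊗ₘ we_iso w y) ∘ we_lax2V w _ _).

Definition qinv_lax0 : munit ~> we_obj w munit :=
  we_full w (we_isoV w munit ∘ we_lax0V w).

Lemma qinv_mapE (x y : D) (f : x ~> y) :
  we_iso w y ∘ fmap K (qinv_map f) = f ∘ we_iso w x.
Proof. by rewrite we_fullK !compA we_isoKV comp1m. Qed.

Lemma qinv_lax2E (x y : D) :
  we_iso w (x ⊗ y) ∘ fmap K (qinv_lax2 x y) ∘ lax2 K _ _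
  = we_iso w x ⊗ₘ we_iso w y.
Proof. by rewrite we_fullK !compA we_isoKV comp1m -compA we_lax2VK compm1. Qed.

Lemma qinv_lax0E : we_iso w munit ∘ fmap K qinv_lax0 ∘ lax0 K = idm munit.
Proof. by rewrite we_fullK !compA we_isoKV comp1m we_lax0VK. Qed.

Lemma qinv_lax2_tens (x y : D) (a b : C)
    (f : a ~> we_obj w x) (g : b ~> we_obj w y) :
  we_iso w (x ⊗ y) ∘ fmap K (qinv_lax2 x y ∘ (f ⊗ₘ g)) ∘ lax2 K a b
  = (we_iso w x ∘ fmap K f) ⊗ₘ (we_iso w y ∘ fmap K g).
Proof. by rewrite fmapM -!compA -lax2_nat !compA qinv_lax2E tensmM. Qed.

Program Definition qinv_functor : functor D C :=
  {| fobj := we_obj w; fmap := qinv_map |}.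
Next Obligation.
by move=> x; apply: we_inj; rewrite qinv_mapE fmap1 comp1m compm1.
Qed.
Next Obligation.
move=> x y z g f; apply: we_inj.
by rewrite qinv_mapE fmapM !compA qinv_mapE -!compA qinv_mapE.
Qed.

Program Definition qinv : lax_functor D C :=
  {| lfun := qinv_functor; lax2 := qinv_lax2; lax0 := qinv_lax0 |}.
Next Obligation.
move=> x y x' y' f g /=; apply: we_inj; apply: (iso_epi (we_lax2_iso _ _)).
rewrite qinv_lax2_tens !qinv_mapE fmapM compA qinv_mapE -!compA.
by rewrite (compA (we_iso w _)) qinv_lax2E tensmM.
Qed.
Next Obligation.
move=> x y z /=; apply: we_inj; apply: (iso_epi (we_lax2_iso _ _)).
apply: (iso_epi (tensm_iso (we_lax2_iso _ _) (idm_iso _))).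
have L := qinv_lax2_tens (qinv_lax2 x y) (idm (we_obj w z)).
have R := qinv_lax2_tens (idm (we_obj w x)) (qinv_lax2 y z).
have KA := lax2_assoc K (we_obj w x) (we_obj w y) (we_obj w z).
(* Once tested against [we_iso] and the structure maps of [K], both sides equal this morphism: the
   left one by [qinv_mapE] and [qinv_lax2_tens], the right one by the associativity coherence of [K]
   and naturality of [assoc]. *)
transitivity (assoc x y z ∘ ((we_iso w x ⊗ₘ we_iso w y) ⊗ₘ we_iso w z)).
  rewrite -(compA (qinv_map _)) (fmapM K) (compA (we_iso w _)) qinv_mapE.
  rewrite -!compA; congr (_ ∘ _).
  rewrite (compA (fmap K _)) (compA (we_iso w _)) !compA L -tensmM.
  by rewrite qinv_lax2E fmap1 !compm1.
rewrite (fmapM K (_ ∘ _)) -!compA (compA (fmap K (assoc _ _ _))) KA.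
by rewrite !compA R -tensmM qinv_lax2E fmap1 !compm1 assoc_nat.
Qed.
Next Obligation.
move=> x /=; apply: we_inj; apply: (iso_epi (we_lax2_iso _ _)).
apply: (iso_epi (tensm_iso we_lax0_iso (idm_iso _))).
have L := qinv_lax2_tens qinv_lax0 (idm (we_obj w x)).
have U := lax_lunit K (we_obj w x).
transitivity (lunit x ∘ (idm munit ⊗ₘ we_iso w x)).
  rewrite -(compA (qinv_map _)) (fmapM K) (compA (we_iso w _)) qinv_mapE.
  rewrite -!compA; congr (_ ∘ _).
  by rewrite !compA L -tensmM qinv_lax0E fmap1 !compm1.
by rewrite lunit_nat -!compA; congr (_ ∘ _); rewrite compA U.
Qed.
Next Obligation.
move=> x /=; apply: we_inj; apply: (iso_epi (we_lax2_iso _ _)).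
apply: (iso_epi (tensm_iso (idm_iso _) we_lax0_iso)).
have L := qinv_lax2_tens (idm (we_obj w x)) qinv_lax0.
have U := lax_runit K (we_obj w x).
transitivity (runit x ∘ (we_iso w x ⊗ₘ idm munit)).
  rewrite -(compA (qinv_map _)) (fmapM K) (compA (we_iso w _)) qinv_mapE.
  rewrite -!compA; congr (_ ∘ _).
  by rewrite !compA L -tensmM qinv_lax0E fmap1 !compm1.
by rewrite runit_nat -!compA; congr (_ ∘ _); rewrite compA U.
Qed.

(** Its axioms are the characterizing equations of [qinv_map], [qinv_lax2] and [qinv_lax0]. *)
Program Definition qinv_counit : mon_trans (lax_comp K qinv) (lax_id D) :=
  {| mtr := we_iso w |}.
Next Obligation. by move=> x y f; exact: qinv_mapE. Qed.
Next Obligation. by move=> x y /=; rewrite compA qinv_lax2E comp1m. Qed.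
Next Obligation. by rewrite /= compA qinv_lax0E. Qed.

Definition qinv_counitV : mon_trans (lax_id D) (lax_comp K qinv) :=
  mtr_inv (t := qinv_counit) (we_isoVK w) (we_isoKV w).

Definition qinv_unit_map (a : C) : a ~> we_obj w (K a) :=
  we_full w (we_isoV w (K a)).

Definition qinv_unitV_map (a : C) : we_obj w (K a) ~> a :=
  we_full w (we_iso w (K a)).

Lemma qinv_unitE (a : C) : we_iso w (K a) ∘ fmap K (qinv_unit_map a) = idm (K a).
Proof. by rewrite we_fullK we_isoKV. Qed.

Lemma qinv_unitVK (a : C) : qinv_unitV_map a ∘ qinv_unit_map a = idm a.
Proof. by apply: (we_faithful w); rewrite fmapM !we_fullK we_isoKV fmap1. Qed.

Lemma qinv_unitKV (a : C) :
  qinv_unit_map a ∘ qinv_unitV_map a = idm (we_obj w (K a)).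
Proof. by apply: (we_faithful w); rewrite fmapM !we_fullK we_isoVK fmap1. Qed.

Program Definition qinv_unit : mon_trans (lax_id C) (lax_comp qinv K) :=
  {| mtr := qinv_unit_map |}.
Next Obligation.
move=> a b f /=; apply: we_inj.
by rewrite !fmapM !compA qinv_mapE qinv_unitE -compA qinv_unitE comp1m compm1.
Qed.
Next Obligation.
move=> a b /=; rewrite compm1; apply: we_inj; apply: (iso_epi (we_lax2_iso _ _)).
have L := qinv_lax2_tens (qinv_unit_map a) (qinv_unit_map b).
rewrite qinv_unitE comp1m -(compA (qinv_map _)) (fmapM K (qinv_map _)).
rewrite (compA (we_iso w _)) qinv_mapE -!compA (compA (we_iso w _)) L.
by rewrite !qinv_unitE tensm1 compm1.
Qed.
Next Obligation.
rewrite /= compm1; apply: we_inj; apply: (iso_epi we_lax0_iso).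
rewrite qinv_unitE comp1m (fmapM K) (compA (we_iso w _)) qinv_mapE.
by rewrite -!compA (compA (we_iso w _)) qinv_lax0E compm1.
Qed.

Definition qinv_unitV : mon_trans (lax_comp qinv K) (lax_id C) :=
  mtr_inv (t := qinv_unit) qinv_unitVK qinv_unitKV.

End QuasiInverse.

(** * The comparison functor from the Kleisli category *)

Section Comparison.
Context (C D : monoidal_category) (A : mon_adjunction C D).

Let G := ladj A.
Let R := radj A.
Let T := adj_monad A.

Definition transpose (a : C) (x : D) (f : a ~> R x) : G a ~> x :=
  adj_counit A x ∘ fmap G f.

Definition untranspose (a : C) (x : D) (h : G a ~> x) : a ~> R x :=
  fmap R h ∘ adj_unit A a.

Lemma transposeK (a : C) (x : D) (f : a ~> R x) : untranspose (transpose f) = f.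
Proof.
have /= E := mtr_nat (adj_unit A) f.
by rewrite /untranspose fmapM -compA -E compA adj_triangle_r comp1m.
Qed.

Lemma untransposeK (a : C) (x : D) (h : G a ~> x) : transpose (untranspose h) = h.
Proof.
have /= E := mtr_nat (adj_counit A) h.
by rewrite /transpose fmapM compA E -compA adj_triangle_l compm1.
Qed.

(** The oplax structure on [G] that is the mate of the lax structure of [R]. *)
Definition ladj_lax2V (a b : C) : G (a ⊗ b) ~> G a ⊗ G b :=
  transpose (lax2 R _ _ ∘ (adj_unit A a ⊗ₘ adj_unit A b)).

Definition ladj_lax0V : G munit ~> munit := transpose (lax0 R).

(** Monoidality of the counit reduces the composite to a tensor product of two left triangle
    identities. *)
Lemma ladj_lax2VK (a b : C) : ladj_lax2V a b ∘ lax2 G a b = idm (G a ⊗ G b).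
Proof.
have /= E := mtr_lax2 (adj_counit A) (G a) (G b); rewrite comp1m in E.
rewrite /ladj_lax2V /transpose fmapM -!compA -lax2_nat.
rewrite compA in E; rewrite !compA E -tensmM.
by rewrite !adj_triangle_l tensm1.
Qed.

(** Here monoidality of the unit, with naturality of the counit, reduces the composite to a single
    left triangle identity. *)
Lemma ladj_lax2KV (a b : C) : lax2 G a b ∘ ladj_lax2V a b = idm (G (a ⊗ b)).
Proof.
have /= E := mtr_lax2 (adj_unit A) a b; rewrite compm1 in E.
have /= N := mtr_nat (adj_counit A) (lax2 G a b).
rewrite /ladj_lax2V /transpose compA -N -compA -fmapM compA -E.
by rewrite adj_triangle_l.
Qed.

Lemma ladj_lax0VK : ladj_lax0V ∘ lax0 G = idm munit.
Proof. by have /= E := mtr_lax0 (adj_counit A); rewrite -compA. Qed.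

Lemma ladj_lax0KV : lax0 G ∘ ladj_lax0V = idm (G munit).
Proof.
have /= E := mtr_lax0 (adj_unit A); rewrite compm1 in E.
have /= N := mtr_nat (adj_counit A) (lax0 G).
by rewrite /ladj_lax0V /transpose compA -N -compA -fmapM -E adj_triangle_l.
Qed.

(** As the multiplication of [T] is the image of a counit under [R], naturality of the counit
    suffices. *)
Lemma transpose_comp (a b c : C) (g : b ~> T c) (f : a ~> T b) :
  transpose (kl_comp g f) = transpose g ∘ transpose f.
Proof.
have /= E := mtr_nat (adj_counit A) (adj_counit A (G c)).
have /= N := mtr_nat (adj_counit A) (fmap G g).
rewrite /kl_comp /transpose /= !fmapM !compA E -!compA; congr (_ ∘ _).
by rewrite !compA N.
Qed.

Lemma transpose_free (a b : C) (f : a ~> b) : transpose (kl_free T f) = fmap G f.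
Proof. by rewrite /transpose /kl_free fmapM compA adj_triangle_l comp1m. Qed.

Lemma transpose_unit (a : C) : transpose (adj_unit A a) = idm (G a).
Proof. exact: adj_triangle_l. Qed.

Lemma transpose_tens (a b c d : C) (f : a ~> T b) (g : c ~> T d) :
  transpose (kl_tens f g) ∘ lax2 G a c = lax2 G b d ∘ (transpose f ⊗ₘ transpose g).
Proof.
have /= E := mtr_lax2 (adj_counit A) (G b) (G d); rewrite comp1m in E.
have /= N := mtr_nat (adj_counit A) (lax2 G b d).
rewrite /transpose /kl_tens /= !fmapM tensmM -E -!compA -lax2_nat.
by rewrite !compA N.
Qed.

Program Definition comparison_functor : functor (kleisli T) D :=
  {| fobj := fun a : C => G a; fmap := fun a b f => @transpose a (G b) f |}.
Next Obligation. exact: transpose_unit. Qed.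
Next Obligation. by move=> a b c g f; exact: transpose_comp. Qed.

Program Definition comparison : lax_functor (kleisli_mon T) D :=
  {| lfun := comparison_functor;
     lax2 := fun a b => lax2 G a b;
     lax0 := lax0 G |}.
Next Obligation. by move=> a b a' b' f g /=; rewrite transpose_tens. Qed.
Next Obligation. by move=> a b c /=; rewrite transpose_free lax2_assoc. Qed.
Next Obligation. by move=> a /=; rewrite transpose_free lax_lunit. Qed.
Next Obligation. by move=> a /=; rewrite transpose_free lax_runit. Qed.

(** Both transformations have identity components: the comparison functor composed with [free T]
    agrees with [G], and [R] composed with it agrees with [forg T]. *)
Program Definition comparison_mor : adj_mor (kleisli_adj T) A :=
  {| am_l := lax_id C;
     am_r := comparison;
     am_alpha := {| mtr := fun a : C => idm (G a) |};
     am_beta := {| mtr := fun a : C => idm (R (G a)) |} |}.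
Next Obligation. by move=> a b f /=; rewrite transpose_free comp1m compm1. Qed.
Next Obligation.
by move=> a b /=; rewrite transpose_unit fmap1 tensm1 !comp1m !compm1.
Qed.
Next Obligation. by rewrite /= transpose_unit fmap1 ?(comp1m, compm1). Qed.
Next Obligation.
by move=> a b f /=; rewrite /transpose fmapM comp1m compm1.
Qed.
Next Obligation. by move=> a b /=; rewrite tensm1 comp1m !compm1. Qed.
Next Obligation. by rewrite /= comp1m compm1. Qed.
Next Obligation.
move=> a /=; rewrite /transpose fmap1 compm1 fmap1 compm1.
by rewrite adj_triangle_r.
Qed.

(** The comparison has the object map of [G], so essential surjectivity carries over. Indefinite
    description enters only here, to choose preimages together with inverse isomorphisms. *)
Lemma comparison_weq : essentially_surjective G ->
  inhabited (weak_equivalence comparison).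
Proof.
move=> hG.
have iso_ex x : {a : C & {p : (G a ~> x) * (x ~> G a) |
    p.2 ∘ p.1 = idm (G a) /\ p.1 ∘ p.2 = idm x}}.
  have [a ea] := constructive_indefinite_description _ (hG x).
  exists a; apply: constructive_indefinite_description.
  by have [f [g gf]] := ea; exists (f, g).
constructor; unshelve refine (@WeakEquivalence _ _ comparison
  (fun a b (h : G a ~> G b) => untranspose h) _ _
  (fun x => projT1 (iso_ex x))
  (fun x => (proj1_sig (projT2 (iso_ex x))).1)
  (fun x => (proj1_sig (projT2 (iso_ex x))).2) _ _
  ladj_lax2V ladj_lax2VK ladj_lax2KV ladj_lax0V ladj_lax0VK ladj_lax0KV).
- by move=> a b h; exact: untransposeK.
- by move=> a b f g /= E; rewrite -(transposeK f) E transposeK.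
- by move=> x; case: (projT2 (iso_ex x)) => p [].
- by move=> x; case: (projT2 (iso_ex x)) => p [].
Qed.

Program Definition comparison_inv (w : weak_equivalence comparison) :
    adj_mor A (kleisli_adj T) :=
  {| am_l := lax_id C;
     am_r := qinv w;
     am_alpha := {| mtr := fun a : C => qinv_unit w a |};
     am_beta := {| mtr := fun x : D => fmap R (we_isoV w x) |} |}.
Next Obligation.
move=> w a b f; have /= E := mtr_nat (qinv_unit w) (kl_free T f).
by rewrite transpose_free in E.
Qed.
Next Obligation.
move=> w a b; have /= E := mtr_lax2 (qinv_unit w) a b.
by rewrite /= kl_comp_freel fmap1 comp1m.
Qed.
Next Obligation.
move=> w; have /= E := mtr_lax0 (qinv_unit w).
by rewrite kl_comp_freel fmap1 comp1m.
Qed.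
Next Obligation.
move=> w x y f; have /= E := mtr_nat (qinv_counitV w) f.
by rewrite -!fmapM E.
Qed.
Next Obligation.
move=> w x y; have /= E := mtr_lax2 (qinv_counitV w) x y.
rewrite compm1 /transpose in E.
by rewrite /= compm1 E !fmapM -!compA lax2_nat.
Qed.
Next Obligation.
move=> w; have /= E := mtr_lax0 (qinv_counitV w).
rewrite compm1 /transpose in E.
by rewrite /= compm1 E !compA -!fmapM.
Qed.
Next Obligation.
move=> w x.
(* The image under [R] of this equation, precomposed with the unit, is the mate condition up to the
   right triangle identity. *)
have E : transpose (qinv_map w (adj_counit A x))
    ∘ transpose (qinv_unit_map w (R x)) = we_isoV w x ∘ adj_counit A x.
  apply: (iso_mono (we_iso_iso w x)).
  have /= M := qinv_mapE w (adj_counit A x).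
  have /= U := qinv_unitE w (R x).
  by rewrite compA M -compA U compA we_isoKV comp1m compm1.
rewrite /transpose in E.
rewrite /= -!fmapM E fmapM -compA.
by rewrite adj_triangle_r compm1.
Qed.

End Comparison.

(** * Invertible 2-morphisms and the equivalence *)

Program Definition lax_comp1m (C D : monoidal_category) (F : lax_functor C D) :
    mon_trans (lax_comp (lax_id D) F) F :=
  {| mtr := fun a => idm (F a) |}.
Next Obligation. by move=> *; rewrite comp1m compm1. Qed.
Next Obligation. by move=> *; rewrite /= tensm1 comp1m !compm1. Qed.
Next Obligation. by move=> *; rewrite /= comp1m compm1. Qed.

(** Compatibility of the inverse components with [am_alpha] and [am_beta] follows from that of [s]
    by cancellation, so it need be checked in one direction only. *)
Lemma adj_cell_invertible (C D C' D' : monoidal_category)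
    (A : mon_adjunction C D) (A' : mon_adjunction C' D') (f1 f2 : adj_mor A A')
    (s : adj_cell f1 f2) (tl : forall a, am_l f2 a ~> am_l f1 a)
    (tr : forall x, am_r f2 x ~> am_r f1 x)
    (tls : forall a, tl a ∘ ac_l s a = idm _) (stl : forall a, ac_l s a ∘ tl a = idm _)
    (trs : forall x, tr x ∘ ac_r s x = idm _) (str : forall x, ac_r s x ∘ tr x = idm _) :
  adj_mor_iso f1 f2.
Proof.
have ha a : am_alpha f1 a ∘ fmap (ladj A') (tl a) = tr (ladj A a) ∘ am_alpha f2 a.
  rewrite -[LHS]comp1m -(trs (ladj A a)) -compA (compA (ac_r s _)) -ac_alpha.
  by rewrite -(compA (am_alpha f2 a)) -fmapM stl fmap1 compm1.
have hb x : am_beta f1 x ∘ tl (radj A x) = fmap (radj A') (tr x) ∘ am_beta f2 x.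
  rewrite -[LHS]comp1m /= -fmap1 -(trs x) fmapM -compA (compA (fmap _ (ac_r s x))).
  by rewrite -ac_beta -(compA (am_beta f2 x)) stl compm1.
exists s, (@AdjCell _ _ _ _ _ _ f2 f1 (mtr_inv tls stl) (mtr_inv trs str) ha hb).
by split; split=> /=.
Qed.

Theorem theorem4 (C D : monoidal_category) (A : mon_adjunction C D)
  (hproj : projection_formula A) (hsurj : essentially_surjective (ladj A)) :
  adj_equivalent A (kleisli_adj (adj_monad A)).
Proof.
have [w] := comparison_weq hsurj.
exists (comparison_inv w), (comparison_mor A); split.
(* On [C] the 2-morphism has identity components. It is [lax_comp1m] and not [mtr_id], since the
   structure maps of a composite of identity functors carry extra identity factors. *)
- unshelve refine (adj_cell_invertible (s := @AdjCell _ _ _ _ _ _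
    (adj_mor_comp (comparison_mor A) (comparison_inv w)) (adj_mor_id A)
    (lax_comp1m (lax_id C)) (qinv_counit w) _ _)
    (tl := fun a => idm a) (tr := we_isoV w) _ _ _ _).
  + move=> a /=; have /= U := qinv_unitE w a.
    by rewrite fmap1 !compm1 U.
  + by move=> x /=; rewrite !comp1m -fmapM we_isoKV fmap1.
  + by move=> a; exact: comp1m.
  + by move=> a; exact: comp1m.
  + exact: we_isoVK.
  + exact: we_isoKV.
(* The 2-morphism must end at the identity, so it is built from [qinv_unitV], with the unit as its
   inverse. *)
- unshelve refine (adj_cell_invertible (s := @AdjCell _ _ _ _ _ _
    (adj_mor_comp (comparison_inv w) (comparison_mor A))
    (adj_mor_id (kleisli_adj (adj_monad A)))
    (lax_comp1m (lax_id C)) (qinv_unitV w) _ _)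
    (tl := fun a => idm a) (tr := qinv_unit_map w) _ _ _ _).
  + move=> a /=; have /= -> := fmap1 (qinv w) (ladj A a).
    have /= -> := comp1m (qinv_unit_map w a); have /= -> := qinv_unitVK w a.
    by rewrite kl_comp_freer compm1.
  + move=> a /=; have /= E := we_fullK w (we_iso w (ladj A a)).
    rewrite /transpose in E.
    by rewrite !compm1 -!fmapM E we_isoKV fmap1.
  + by move=> a; exact: comp1m.
  + by move=> a; exact: comp1m.
  + exact: qinv_unitKV.
  + exact: qinv_unitVK.
Qed.
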